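(* Let $\mu,\nu$ be pre-permutons such that $\widetilde\lambda^\mu=\widetilde\lambda^\nu$ (as functions on $[0,1]^2$). Then $\mu^{\mathrm{incr}}=\nu^{\mathrm{incr}}$.
   Context: $\mathbb{N}^*=\{1,2,\dots\}$. A pre-permuton is a Borel probability measure on $[0,1]^2$ whose two marginals have no atoms. A subset $A\subset[0,1]^2$ is nondecreasing (resp. nonincreasing) if for all $(x_1,y_1),(x_2,y_2)\in A$, $(x_2-x_1)(y_2-y_1)\ge 0$ (resp. $\le 0$). It is $k$-nondecreasing (resp. $k$-nonincreasing) if it is a union of $k$ nondecreasing (resp. nonincreasing) subsets. For a finite Borel measure $\rho$ on $[0,1]^2$ and $k\in\mathbb{N}^*$, $\widetilde{\mathrm{LIS}}_k(\rho):=\sup_A \rho(A)$ over closed $k$-nondecreasing $A\subset[0,1]^2$, and $\widetilde{\mathrm{LDS}}_k(\rho):=\sup_A\rho(A)$ over closed $k$-nonincreasing $A$; $\widetilde{\mathrm{LIS}}_0(\rho)=\widetilde{\mathrm{LDS}}_0(\rho):=0$; $\widetilde{\mathrm{LIS}}_\infty:=\lim_k\widetilde{\mathrm{LIS}}_k$ and $\widetilde{\mathrm{LDS}}_\infty:=\lim_k\widetilde{\mathrm{LDS}}_k$. For $(x,y)\in[0,1]^2$, $\widetilde\lambda^\rho(x,y):=\big(\widetilde{\mathrm{LIS}}_k(\rho|_{[0,x]\times[0,y]})-\widetilde{\mathrm{LIS}}_{k-1}(\rho|_{[0,x]\times[0,y]})\big)_{k\in\mathbb{N}^*}$, with unnormalized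 restriction. For a pre-permuton $\mu$, $\mu^{\mathrm{incr}}$ is the first component of the unique triple $(\mu^{\mathrm{incr}},\mu^{\mathrm{decr}},\mu^{\mathrm{sub}})$ of finite Borel measures on $[0,1]^2$ such that $\mu=\mu^{\mathrm{incr}}+\mu^{\mathrm{decr}}+\mu^{\mathrm{sub}}$, $\widetilde{\mathrm{LIS}}_\infty(\mu^{\mathrm{incr}})=\mu^{\mathrm{incr}}([0,1]^2)=\widetilde{\mathrm{LIS}}_\infty(\mu)$ and $\widetilde{\mathrm{LDS}}_\infty(\mu^{\mathrm{decr}})=\mu^{\mathrm{decr}}([0,1]^2)=\widetilde{\mathrm{LDS}}_\infty(\mu)$ (such a triple exists and is unique). *)

(* Defs.v *)
From HB Require Import structures.
From mathcomp Require Import all_boot all_order all_algebra.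
From mathcomp Require Import all_classical all_reals all_analysis.

Set Implicit Arguments.
Unset Strict Implicit.
Unset Printing Implicit Defensive.
Import Order.TTheory GRing.Theory Num.Theory.
Import numFieldNormedType.Exports.
Local Open Scope classical_set_scope.
Local Open Scope ring_scope.
Local Open Scope ereal_scope.

(* Borel measures on [0,1]^2 are encoded as measures on R * R (whose product
   sigma-algebra is the Borel one) that give mass 0 to the complement of
   [0,1]^2. *)

Section Shapes.
Variable R : realType.
Implicit Types A : set (R * R).

Definition rect (p : R * R) : set (R * R) :=
  `[0%R, p.1] `*` `[0%R, p.2].

Lemma measurable_rect p : measurable (rect p).
Proof. by apply: measurableX; exact: measurable_itv. Qed.

Definition unit_square : set (R * R) := rect (1%R, 1%R).

Definition nondecreasing_set A :=
  forall p q, A p -> A q -> (0 <= (q.1 - p.1) * (q.2 - p.2))%R.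

Definition nonincreasing_set A :=
  forall p q, A p -> A q -> ((q.1 - p.1) * (q.2 - p.2) <= 0)%R.

Definition k_nondecreasing (k : nat) A :=
  exists B : 'I_k -> set (R * R),
    (forall i, nondecreasing_set (B i)) /\ A = \bigcup_i B i.

Definition k_nonincreasing (k : nat) A :=
  exists B : 'I_k -> set (R * R),
    (forall i, nonincreasing_set (B i)) /\ A = \bigcup_i B i.

End Shapes.
Arguments unit_square {R}.

Section MonotoneMass.
Variable R : realType.
Implicit Types (rho mu : {finite_measure set (R * R)%type -> \bar R}) (k : nat).

Definition carried_by_unit_square rho := rho (~` unit_square) = 0.

Definition LIS k rho : \bar R :=
  if k is 0%N then 0 else
  ereal_sup [set rho A | A in
    [set A | [/\ A `<=` unit_square, closed A & k_nondecreasing k A]]].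

Definition LDS k rho : \bar R :=
  if k is 0%N then 0 else
  ereal_sup [set rho A | A in
    [set A | [/\ A `<=` unit_square, closed A & k_nonincreasing k A]]].

Definition LIS_infty rho : \bar R := limn (fun k => LIS k rho).

Definition LDS_infty rho : \bar R := limn (fun k => LDS k rho).

(* The sequence is indexed from 0: its entry number k is the (k+1)-st row. *)
Definition lambda rho (p : R * R) : nat -> \bar R := fun k =>
  LIS k.+1 (mrestr rho (measurable_rect p)) -
  LIS k (mrestr rho (measurable_rect p)).

Definition prepermuton (mu : probability (R * R)%type R) :=
  [/\ carried_by_unit_square mu,
      forall x : R, pushforward mu (@fst R R) [set x] = 0 &
      forall y : R, pushforward mu (@snd R R) [set y] = 0].

Definition monotone_decomposition mu
    (mi md ms : {finite_measure set (R * R)%type -> \bar R}) :=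
  [/\ [/\ carried_by_unit_square mi, carried_by_unit_square md &
          carried_by_unit_square ms],
      forall A, measurable A -> mu A = mi A + md A + ms A,
      LIS_infty mi = mi unit_square /\ mi unit_square = LIS_infty mu &
      LDS_infty md = md unit_square /\ md unit_square = LDS_infty mu].

(* For a pre-permuton the decomposition exists, so the default value is not
   used, and it is unique up to the irrelevant values that the measures take on
   non-measurable sets. *)
Definition incr_part mu : {finite_measure set (R * R)%type -> \bar R} :=
  xget (mzero : {classic {finite_measure set (R * R)%type -> \bar R}})
    [set mi | exists md ms, monotone_decomposition mu mi md ms].

End MonotoneMass.

(* Main.v *)
(* The finite unions of closed nondecreasing sets are stable under union, so
   some countable union E of them has maximal mu-mass LIS_infty(mu).  Every other
   such union is contained in E up to a mu-null set, whence
   LIS_infty(mu|_D) = mu(E `&` D) for every measurable D, and mu^incr must be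
   mu|_E.  Summing the rows of lambda at (x, y) gives LIS_infty of mu restricted to
   [0,x] * [0,y], that is mu^incr([0,x] * [0,y]), and these rectangles determine a
   measure on the unit square.
   The decomposition exists because a nondecreasing set which is also
   nonincreasing lies on a horizontal or vertical line, which a pre-permuton does
   not charge. *)
Require Import Defs.
From mathcomp Require Import all_boot all_order all_algebra.
From mathcomp Require Import all_classical all_reals all_analysis.
From mathcomp Require Import measurable_realfun.
Local Open Scope classical_set_scope.

Set Implicit Arguments.
Unset Strict Implicit.
Unset Printing Implicit Defensive.
Import Order.TTheory GRing.Theory Num.Theory.
Import numFieldNormedType.Exports.

(** * Maximal mass over a class of measurable sets closed under finite unions *)

Section SupMass.
Local Open Scope ring_scope.
Local Open Scope ereal_scope.
Context d (T : measurableType d) (R : realType).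
Implicit Types (G : set (set T)) (A B D E F : set T).
Implicit Types rho mu nu : {finite_measure set T -> \bar R}.

Definition sup_mass G rho : \bar R := ereal_sup [set rho A | A in G].

Definition countable_unions G : set (set T) :=
  [set E | exists2 F : nat -> set T, forall n, G (F n) & E = \bigcup_n F n].

Record union_class G : Prop := UnionClass {
  union_class_measurable : G `<=` measurable;
  union_class0 : G set0;
  union_classU : setU_closed G }.

Lemma sub_countable_unions G A : G A -> countable_unions G A.
Proof. by move=> GA; exists (fun=> A) => //; rewrite bigcup_const. Qed.

Lemma measurable_countable_unions G E :
  union_class G -> countable_unions G E -> measurable E.
Proof.
move=> GP [F GF ->]; apply: bigcupT_measurable => n.
exact/(union_class_measurable GP).
Qed.

Lemma countable_unionsU G E F : union_class G ->
  countable_unions G E -> countable_unions G F -> countable_unions G (E `|` F).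
Proof.
move=> GP [A GA ->] [B GB ->]; exists (fun n => A n `|` B n).
  by move=> n; apply: (union_classU GP).
by rewrite bigcupU.
Qed.

(** The finite partial unions stay in [G], and continuity from below carries the bound over to their
    countable union. *)
Lemma le_sup_mass G rho E : union_class G ->
  countable_unions G E -> rho E <= sup_mass G rho.
Proof.
move=> GP [F GF ->].
have GUF n : G (\big[setU/set0]_(i < n) F i).
  by elim/big_ind : _ => [|A B|//]; [exact: union_class0|exact: union_classU].
rewrite -bigcup_bigsetU_bigcup.
have cvgF : rho (\big[setU/set0]_(i < n.+1) F i) @[n --> \oo] -->
    rho (\bigcup_n \big[setU/set0]_(i < n.+1) F i).
  apply: (@nondecreasing_cvg_mu _ _ _ rho
      (fun n => \big[setU/set0]_(i < n.+1) F i)).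
  - by move=> n; exact/(union_class_measurable GP).
  - by apply: bigcupT_measurable => n; exact/(union_class_measurable GP).
  - by move=> m n mn; apply/subsetPset; exact: subset_bigsetU.
rewrite -(cvg_lim (@ereal_hausdorff R) cvgF).
apply: lime_le; first by apply/cvg_ex; eexists; exact: cvgF.
by apply: nearW => n; apply: ereal_sup_ubound; exists (\big[setU/set0]_(i < n.+1) F i).
Qed.

Lemma sup_mass_fin_num G rho : union_class G -> sup_mass G rho \is a fin_num.
Proof.
move=> GP; rewrite ge0_fin_numE; last first.
  by apply: ereal_sup_ubound; exists set0; [exact: union_class0|exact: measure0].
apply: (@le_lt_trans _ _ (rho setT)); last first.
  by rewrite -ge0_fin_numE//; exact: fin_num_measure.
apply: ge_ereal_sup => _ [A GA <-].
by apply: le_measure; rewrite ?inE//; exact/(union_class_measurable GP).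
Qed.

(** The union of a maximizing sequence works: its n-th member misses the supremum by less than
    [n.+1%:R^-1], and [le_sup_mass] prevents the union from exceeding it. *)
Lemma sup_mass_attained G rho : union_class G ->
  exists2 E, countable_unions G E & rho E = sup_mass G rho.
Proof.
move=> GP; have sfin := sup_mass_fin_num rho GP.
have /choice[F FP] n : exists A, G A /\ sup_mass G rho - (n.+1%:R^-1)%:E < rho A.
  have [|_ [A GA <-] ltA] := @ub_ereal_sup_adherent R _ n.+1%:R^-1 _ sfin.
    by rewrite invr_gt0 ltr0n.
  by exists A.
have GE : countable_unions G (\bigcup_n F n) by exists F => // n; case: (FP n).
exists (\bigcup_n F n) => //; apply/eqP; rewrite eq_le le_sup_mass//=.
apply/lee_addgt0Pr => e e0.
have [n _ /(_ n (leqnn n)) /= ne] := near_infty_natSinv_lt (PosNum e0).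
have [GFn] := FP n; rewrite lteBlDr// => /ltW/le_trans; apply.
apply: leeD; last by rewrite lee_fin ltW.
apply: le_measure; rewrite ?inE; last exact: bigcup_sup.
- exact/(union_class_measurable GP).
- exact: measurable_countable_unions GE.
Qed.

Definition mass_maximizer G rho E := countable_unions G E /\ rho E = sup_mass G rho.

(** Otherwise the countable union [E] with [F] added would have mass [rho E + rho (F \ E)], above
    the supremum. Finiteness of [rho E] allows the cancellation. *)
Lemma mass_maximizer_diff G rho E F : union_class G ->
  mass_maximizer G rho E -> countable_unions G F -> rho (F `\` E) = 0.
Proof.
move=> GP [GE rhoE] GF.
have mE := measurable_countable_unions GP GE.
have mF := measurable_countable_unions GP GF.
have := le_sup_mass rho GP (countable_unionsU GP GE GF).
rewrite -rhoE -[X in rho X](setDUK (@subsetUl _ E F)) setDUl setDv set0U.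
rewrite measureU//; [|exact: measurableD|by rewrite setDIK].
rewrite -[X in _ <= X]adde0 leeD2lE ?fin_num_measure// => le0.
by apply/eqP; rewrite eq_le le0 measure_ge0.
Qed.

(** One maximizer for [mu] serves every [D] at once: the part of any member of [G] outside [E] is
    [mu]-null, so inside [D] no member of [G] has more mass than [E]. *)
Lemma sup_mass_mrestr G mu E D (mD : measurable D) : union_class G ->
  mass_maximizer G mu E -> sup_mass G (mrestr mu mD) = mu (E `&` D).
Proof.
move=> GP Emax; have mE := measurable_countable_unions GP Emax.1.
apply/eqP; rewrite eq_le; apply/andP; split; last first.
  exact: (le_sup_mass (mrestr mu mD) GP Emax.1).
apply: ge_ereal_sup => _ [A GA <-].
have mA := union_class_measurable GP GA.
rewrite /= /mrestr (measureDI mu (measurableI _ _ mA mD) mE).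
rewrite (@subset_measure0 _ _ _ _ _ (A `\` E)) ?add0e.
- apply: le_measure; rewrite ?inE; [|exact: measurableI|].
  + by apply: measurableI => //; exact: measurableI.
  + by move=> x [[]].
- by apply: measurableD => //; exact: measurableI.
- exact: measurableD.
- by move=> x [[]].
- exact: mass_maximizer_diff Emax (sub_countable_unions GA).
Qed.

(** The measure [nu] lives on a countable union [F], and [F \ E] is null for [mu], hence for [nu].
    So [nu] lives on [E], where it is dominated by [mu] with the same finite total mass; the two
    must then agree on every part of [E]. *)
Lemma measure_eq_mrestr_maximizer G mu nu E : union_class G ->
    mass_maximizer G mu E -> (forall A, measurable A -> nu A <= mu A) ->
    sup_mass G nu = nu setT -> nu setT = sup_mass G mu ->
  forall A, measurable A -> nu A = mu (A `&` E).
Proof.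
move=> GP Emax numu nuT nuTmu.
have mE := measurable_countable_unions GP Emax.1.
have [F GF nuF] := sup_mass_attained nu GP.
have mF := measurable_countable_unions GP GF.
have nuCF : nu (~` F) = 0.
  have : nu setT = nu (~` F) + nu F.
    by have := measureDI nu measurableT mF; rewrite setTD setTI.
  rewrite nuF nuT => nuTE.
  by rewrite -(@addeK _ (nu setT) (nu (~` F))) -?nuTE ?subee ?fin_num_measure.
have nuCE : nu (~` F `|` (F `\` E)) = 0.
  apply/eqP; rewrite eq_le measure_ge0 andbT.
  apply: (@le_trans _ _ (nu (~` F) + nu (F `\` E))).
    by apply: measureU2; [exact: measurableC|exact: measurableD].
  rewrite nuCF add0e -(mass_maximizer_diff GP Emax GF).
  by apply: numu; exact: measurableD.
have nu_restr A : measurable A -> nu A = nu (A `&` E).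
  move=> mA; rewrite (measureDI nu mA mE).
  rewrite (@subset_measure0 _ _ _ _ _ (~` F `|` (F `\` E))) ?add0e//.
  - exact: measurableD.
  - by apply: measurableU; [exact: measurableC|exact: measurableD].
  - by move=> x [_ nEx]; have [Fx|nFx] := pselect (F x); [right|left].
move=> A mA; rewrite nu_restr//; apply/eqP; rewrite eq_le numu/=; last exact: measurableI.
have := nu_restr _ measurableT; rewrite setTI nuTmu -Emax.2.
rewrite (measureDI mu mE mA) (measureDI nu mE mA) => EE.
(* The reverse inequality comes from complementation in [E]: the total masses on [E] agree, and on
   [E \ A] [nu] is at most [mu]. *)
rewrite setIC -(@leeD2lE _ (mu (E `\` A))); last first.
  by rewrite fin_num_measure//; exact: measurableD.
by rewrite EE leeD2r// numu//; exact: measurableD.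
Qed.


(* Written with the convention of [LIS] and [LDS] at [k = 0], so that it applies to
   both by conversion. *)
Lemma limn_sup_mass (Q : nat -> set (set T)) rho :
    (forall k, Q k set0) ->
    (forall k l A B, Q k A -> Q l B -> Q (k + l)%N (A `|` B)) ->
  limn (fun k => if k is 0%N then 0 else ereal_sup [set rho A | A in Q k]) =
  sup_mass (\bigcup_k Q k) rho.
Proof.
move=> Q0 QU; set u := fun k => _.
(* The classes increase with the index, by padding with the empty set taken from [Q (l - k)]. *)
have Qle k l A : (k <= l)%N -> Q k A -> Q l A.
  by move=> kl QA; rewrite -(setU0 A) -(subnKC kl); exact: QU.
have u_ge0 k : 0 <= u k.
  by case: k => [//|k]; apply: ereal_sup_ubound; exists set0 => //; exact: measure0.
have nd_u : nondecreasing_seq u.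
  move=> [|k] l; first by move=> _; exact: u_ge0.
  case: l => [//|l] kl.
  by apply: ereal_sup_le => _ [A QA <-]; exists A => //; exact: Qle QA.
rewrite (cvg_lim (@ereal_hausdorff R) (ereal_nondecreasing_cvgn nd_u)).
apply/eqP; rewrite eq_le; apply/andP; split; apply: ge_ereal_sup.
- move=> _ [[|k] _ <-].
    by apply: ereal_sup_ubound; exists set0; [exists 0%N|exact: measure0].
  by apply: ereal_sup_le => _ [A QA <-]; exists A => //; exists k.+1.
(* The index is [k.+1] and not [k] because [u 0] is 0 by convention, whereas a set in [Q 0] may have
   positive mass. *)
- move=> _ [A [k _ QA] <-]; apply: (@le_trans _ _ (u k.+1)); last first.
    by apply: ereal_sup_ubound; exists k.+1.
  by apply: ereal_sup_ubound; exists A => //; exact: Qle QA.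
Qed.

End SupMass.

(** * Closed unions of monotone sets in the plane *)

Section Plane.
Local Open Scope ring_scope.
Context (R : realType).
Implicit Types (A B : set (R * R)) (P : set (R * R) -> Prop).

(** This links the product topology to the product sigma-algebra: an open set is the countable union
    of the boxes with rational centre and radius [n.+1%:R^-1] that it contains. *)
Lemma open_measurable_prod A : open A -> measurable A.
Proof.
move=> oA.
pose box (q : rat * rat * nat) : set (R * R) :=
  ball (ratr q.1.1 : R) q.2.+1%:R^-1 `*` ball (ratr q.1.2 : R) q.2.+1%:R^-1.
pose F q := if `[< box q `<=` A >] then box q else set0.
have -> : A = \bigcup_q F q.
  apply/seteqP; split=> [[x y] Axy|p [q _]]; last first.
    by rewrite /F; case: ifPn => // /asboolP; apply.
  have /nbhs_ballP[e /= e0 eA] := open_nbhs_nbhs (conj oA Axy).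
  (* Two points of one box are compared through its centre, so the radius must stay below half of
     [e]. *)
  have e20 : 0 < e / 2 by rewrite divr_gt0.
  have [n _ /(_ n (leqnn n)) /= ne] := near_infty_natSinv_lt (PosNum e20).
  have n0 : (0 : R) < n.+1%:R^-1 by rewrite invr_gt0.
  have near_rat (z : R) : exists a : rat, ball (ratr a : R) n.+1%:R^-1 z.
    have [||p [zp [a _ ap]]] := @dense_rat R (ball z n.+1%:R^-1).
    - by exists z; exact: ballxx.
    - exact: ball_open.
    by exists a; rewrite ap; exact: ball_sym.
  have [[a ax] [b bY]] := (near_rat x, near_rat y).
  exists (a, b, n) => //; rewrite /F; case: asboolP => [_|]; first by split.
  have ball2 (c z w : R) : ball c n.+1%:R^-1 z -> ball c n.+1%:R^-1 w -> ball z e w.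
    move=> /ball_sym cz /(ball_triangle cz); apply: le_ball.
    by rewrite [leRHS]splitr lerD// ltW.
  by case=> -[x' y'] [/= ax' by']; apply: eA; split; [exact: ball2 ax'|exact: ball2 by'].
apply: countable_bigcupT_measurable => // q.
rewrite /F; case: ifPn => // _.
by apply: measurableX; apply: open_measurable; apply: ball_open; rewrite invr_gt0.
Qed.

Lemma closed_measurable_prod A : closed A -> measurable A.
Proof.
by move=> /closed_openC/open_measurable_prod/measurableC; rewrite setCK.
Qed.

(** The property [P] is a parameter so that [k_nondecreasing] and [k_nonincreasing] are both
    instances by conversion. *)
Definition k_union P (k : nat) A :=
  exists B : 'I_k -> set (R * R), (forall i, P (B i)) /\ A = \bigcup_i B i.

Definition closed_k_union P (k : nat) : set (set (R * R)) :=
  [set A | [/\ A `<=` unit_square, closed A & k_union P k A]].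

Lemma k_unionU P k l A B :
  k_union P k A -> k_union P l B -> k_union P (k + l) (A `|` B).
Proof.
move=> [F [PF ->]] [G [PG ->]].
exists (fun i => match fintype.split i with inl j => F j | inr j => G j end).
split=> [i|]; first by case: fintype.split.
apply/seteqP; split=> [x [[i _ xi]|[j _ xj]]|x [i _]].
- by exists (unsplit (inl i)); rewrite // unsplitK.
- by exists (unsplit (inr j)); rewrite // unsplitK.
- by case: fintype.split => j xj; [left|right]; exists j.
Qed.

Lemma k_union_set0 P k : P set0 -> k_union P k set0.
Proof. by move=> P0; exists (fun=> set0); split=> //; rewrite bigcup0. Qed.

Lemma closed_k_unionU P k l A B :
  closed_k_union P k A -> closed_k_union P l B ->
  closed_k_union P (k + l) (A `|` B).
Proof.
move=> [Asub cA kA] [Bsub cB kB]; split; [|exact: closedU|exact: k_unionU].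
by rewrite subUset.
Qed.

Lemma closed_k_union_set0 P k : P set0 -> closed_k_union P k set0.
Proof.
by move=> P0; split; [exact: sub0set|exact: closed0|exact: k_union_set0].
Qed.

Lemma closed_k_union_class P : P set0 -> union_class (\bigcup_k closed_k_union P k).
Proof.
move=> P0; split.
- by move=> A [k _ [_ /closed_measurable_prod]].
- by exists 0%N => //; exact: closed_k_union_set0.
- move=> A B [k _ kA] [l _ lB]; exists (k + l)%N => //.
  exact: closed_k_unionU.
Qed.

Definition incr_class := \bigcup_k closed_k_union (@nondecreasing_set R) k.
Definition decr_class := \bigcup_k closed_k_union (@nonincreasing_set R) k.

Lemma incr_classP : union_class incr_class.
Proof. exact: closed_k_union_class. Qed.

Lemma decr_classP : union_class decr_class.
Proof. exact: closed_k_union_class. Qed.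

Lemma LIS_inftyE (rho : {finite_measure set (R * R)%type -> \bar R}) :
  LIS_infty rho = sup_mass incr_class rho.
Proof.
apply: (limn_sup_mass (Q := closed_k_union (@nondecreasing_set R))).
- by move=> k; exact: closed_k_union_set0.
- exact: closed_k_unionU.
Qed.

Lemma LDS_inftyE (rho : {finite_measure set (R * R)%type -> \bar R}) :
  LDS_infty rho = sup_mass decr_class rho.
Proof.
apply: (limn_sup_mass (Q := closed_k_union (@nonincreasing_set R))).
- by move=> k; exact: closed_k_union_set0.
- exact: closed_k_unionU.
Qed.

(** * Rectangles at the origin determine a measure on the unit square *)

Local Open Scope ereal_scope.

Implicit Types m : {finite_measure set (R * R)%type -> \bar R}.

(** Quadrants stand in for the rectangles [rect] because they form a pi-system that generates the
    sigma-algebra of the whole plane and exhausts it. *)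
Definition quadrant (a b : R) : set (R * R) := `]-oo, a] `*` `]-oo, b].

Definition quadrants : set (set (R * R)) := [set quadrant p.1 p.2 | p in setT].

Lemma measurable_quadrant a b : measurable (quadrant a b).
Proof. by apply: measurableX; exact: measurable_itv. Qed.

Lemma quadrantI a b a' b' :
  quadrant a b `&` quadrant a' b' = quadrant (Num.min a a') (Num.min b b').
Proof.
apply/seteqP; split=> -[x y]; rewrite /quadrant /= !in_itv /= !le_min.
  by move=> [[-> ->] [-> ->]].
by move=> [/andP[-> ->] /andP[-> ->]].
Qed.

(** Meant for half-planes, obtained by fixing one coordinate of the corner and sending the other to
    infinity. *)
Lemma bigcup_quadrant (h : nat -> R * R) (A : set (R * R)) :
  (forall p, A p <-> exists n, (p.1 <= (h n).1 /\ p.2 <= (h n).2)%R) ->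
  <<s quadrants >> A.
Proof.
move=> AP; rewrite (_ : A = \bigcup_n quadrant (h n).1 (h n).2).
  apply: (@bigcupT_measurable _ (g_sigma_algebraType quadrants)) => n.
  by apply: sub_sigma_algebra; exists (h n).
apply/seteqP; split=> [p /AP[n hn]|p [n _]].
  by exists n => //; rewrite /quadrant /= !in_itv.
by rewrite /quadrant /= !in_itv /= => hn; apply/AP; exists n.
Qed.

(** The product sigma-algebra is the least one making both projections measurable. The preimage of
    an open ray under a projection is the complement of a half-plane, which is a countable union of
    quadrants. *)
Lemma measurable_quadrantsE : measurable = <<s quadrants >>.
Proof.
apply/seteqP; split; last first.
  apply: smallest_sub; first exact: sigma_algebra_measurable.
  by move=> _ [p _ <-]; exact: measurable_quadrant.
(* [Q] is the plane with the sigma-algebra generated by quadrants; measurability of the projections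
   is proved on it. *)
pose Q := g_sigma_algebraType quadrants.
have ray (x : R) : exists n : nat, (x <= n%:R)%R.
  exists (Num.truncn x).+1; exact/ltW/truncnS_gt.
have mfst : measurable_fun setT (fst : Q -> R).
  apply: (measurability _ (RGenOInfty.measurableE R)) => _ [_ [a ->] <-].
  rewrite setTI -[X in measurable X]setCK; apply: measurableC.
  apply: (@bigcup_quadrant (fun n => (a, n%:R)%R)) => -[x y] /=.
  rewrite in_itv /= andbT; split=> [/negP|[n [xa _]]].
    by rewrite -leNgt; have [n] := ray y; exists n.
  by apply/negP; rewrite -leNgt.
have msnd : measurable_fun setT (snd : Q -> R).
  apply: (measurability _ (RGenOInfty.measurableE R)) => _ [_ [a ->] <-].
  rewrite setTI -[X in measurable X]setCK; apply: measurableC.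
  apply: (@bigcup_quadrant (fun n => (n%:R, a)%R)) => -[x y] /=.
  rewrite in_itv /= andbT; split=> [/negP|[n [_ ya]]].
    by rewrite -leNgt; have [n] := ray x; exists n.
  by apply/negP; rewrite -leNgt.
apply: smallest_sub; first exact: smallest_sigma_algebra.
by move=> _ [[B mB <-]|[B mB <-]]; [exact: mfst|exact: msnd].
Qed.

Lemma measurable_unit_square : measurable (unit_square : set (R * R)).
Proof. exact: measurable_rect. Qed.

Lemma carried_setI m A : carried_by_unit_square m -> measurable A ->
  m A = m (A `&` unit_square).
Proof.
move=> mU mA; rewrite (measureDI m mA measurable_unit_square).
rewrite (@subset_measure0 _ _ _ _ _ (~` unit_square)) ?add0e//.
- exact: measurableD measurable_unit_square.
- exact: measurableC measurable_unit_square.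
Qed.

(** By uniqueness on a pi-system it suffices to compare quadrants, and only their traces on the unit
    square carry mass. *)
Lemma measure_eq_rect m1 m2 :
    carried_by_unit_square m1 -> carried_by_unit_square m2 ->
    (forall p : R * R, unit_square p -> m1 (rect p) = m2 (rect p)) ->
  forall A, measurable A -> m1 A = m2 A.
Proof.
move=> m1U m2U m12.
have m12q a b : m1 (quadrant a b) = m2 (quadrant a b).
  rewrite (carried_setI m1U (measurable_quadrant a b)).
  rewrite (carried_setI m2U (measurable_quadrant a b)).
  (* A quadrant whose corner has a negative coordinate misses the unit square. *)
  have [a0|a0] := ltP a 0%R.
    rewrite (_ : _ `&` _ = set0) ?measure0// -subset0 => -[x y].
    rewrite /quadrant /unit_square /rect /= !in_itv /=.
    by move=> [[xa _] [/andP[x0 _] _]]; move: (le_lt_trans xa a0); rewrite ltNge x0.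
  have [b0|b0] := ltP b 0%R.
    rewrite (_ : _ `&` _ = set0) ?measure0// -subset0 => -[x y].
    rewrite /quadrant /unit_square /rect /= !in_itv /=.
    by move=> [[_ yb] [_ /andP[y0 _]]]; move: (le_lt_trans yb b0); rewrite ltNge y0.
  (* Clipping the corner at 1 brings it into the unit square, where the hypothesis on rectangles
     applies. *)
  rewrite (_ : _ `&` _ = rect (Num.min a 1, Num.min b 1)%R); last first.
    apply/seteqP; split=> -[x y].
      rewrite /quadrant /unit_square /rect /= !in_itv /= !le_min.
      by move=> [[-> ->] [/andP[-> ->] /andP[-> ->]]].
    rewrite /quadrant /unit_square /rect /= !in_itv /= !le_min.
    by move=> [/and3P[-> -> ->] /and3P[-> -> ->]].
  apply: m12; rewrite /unit_square /rect /= !in_itv /= !le_min !ge_min !lexx.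
  by rewrite a0 b0 ler01 !orbT.
apply: (measure_unique quadrants (fun n => quadrant n%:R n%:R)).
- exact: measurable_quadrantsE.
- move=> _ _ [p _ <-] [q _ <-]; rewrite quadrantI.
  by exists (Num.min p.1 q.1, Num.min p.2 q.2).
- by move=> n; exists (n%:R, n%:R)%R.
- rewrite -subTset => -[x y] _.
  exists (Num.truncn (Num.max x y)).+1 => //; rewrite /quadrant /= !in_itv /=.
  by have /ltW := truncnS_gt (Num.max x y); rewrite ge_max => /andP[].
- by move=> _ [p _ <-]; exact: m12q.
- by move=> n; rewrite -ge0_fin_numE// fin_num_measure//; exact: measurable_quadrant.
Qed.

End Plane.

(** * Existence of the monotone decomposition and form of its increasing part *)

Section IncreasingPart.
Local Open Scope ring_scope.
Local Open Scope ereal_scope.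
Context (R : realType).
Implicit Types (mu nu : probability (R * R)%type R) (A B E F : set (R * R)).
Implicit Types rho mi md ms : {finite_measure set (R * R)%type -> \bar R}.

(** Any two points of [A] share a coordinate. If [q] is not on the vertical line through [p], it is
    on the horizontal one; a point [r] above or below [p] shares no abscissa with [q], so it must
    share its ordinate. *)
Lemma monotone_both_line A : nondecreasing_set A -> nonincreasing_set A ->
  exists c : R, A `<=` fst @^-1` [set c] \/ A `<=` snd @^-1` [set c].
Proof.
move=> Aincr Adecr.
have Aeq p q : A p -> A q -> p.1 = q.1 \/ p.2 = q.2.
  move=> Ap Aq; have /eqP : ((q.1 - p.1) * (q.2 - p.2) == 0)%R.
    by rewrite eq_le Adecr ?Aincr.
  by move/eqP; rewrite mulf_eq0 !subr_eq0 => /orP[]/eqP ->; [left|right].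
have [[p Ap]|A0] := pselect (A !=set0); last first.
  by exists 0%R; left=> x Ax; case: A0; exists x.
have [fstA|/existsNP[q /not_implyP[Aq /= qp]]] := pselect (A `<=` fst @^-1` [set p.1]).
  by exists p.1; left.
exists p.2; right=> r Ar /=.
have [qp1|qp2] := Aeq q p Aq Ap; first by case: qp.
have [rp1|//] := Aeq r p Ar Ap.
have [rq1|rq2] := Aeq r q Ar Aq; last by rewrite rq2.
by case: qp; rewrite -rq1.
Qed.

(** [A] lies on a line parallel to an axis, which is null since the marginals have no atoms.
    Negligibility replaces mass 0 because the monotone pieces need not be measurable. *)
Lemma negligible_monotone_both mu A : prepermuton mu ->
  nondecreasing_set A -> nonincreasing_set A -> mu.-negligible A.
Proof.
move=> [_ mu1 mu2] Aincr Adecr.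
have [c [Ac|Ac]] := monotone_both_line Aincr Adecr.
- apply: negligibleS Ac _; apply/negligibleP; last exact: mu1.
  by rewrite -[X in measurable X]setTI; exact: measurable_fst.
- apply: negligibleS Ac _; apply/negligibleP; last exact: mu2.
  by rewrite -[X in measurable X]setTI; exact: measurable_snd.
Qed.

Lemma negligible_bigcup_ord mu k (F : 'I_k -> set (R * R)) :
  (forall i, mu.-negligible (F i)) -> mu.-negligible (\bigcup_i F i).
Proof.
move=> F0.
(* The finite family is continued by empty sets to a sequence indexed by [nat]. *)
rewrite (_ : \bigcup_i F i = \bigcup_n oapp F set0 (insub n)).
  by apply: negligible_bigcup => n; case: insub => [i|] /=; [exact: F0|exact: negligible_set0].
apply/seteqP; split=> x.
  by move=> [i _ Fix]; exists (val i) => //; rewrite valK.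
by move=> [n _]; case: insub => [i /= Fix|//]; exists i.
Qed.

(** The intersection is a countable union of sets, each the intersection of a nondecreasing and a
    nonincreasing piece and so monotone in both senses. *)
Lemma incr_decr_negligible mu E F : prepermuton mu ->
  countable_unions (@incr_class R) E -> countable_unions (@decr_class R) F ->
  mu.-negligible (E `&` F).
Proof.
move=> pmu [A incrA ->] [B decrB ->].
rewrite setI_bigcupl; apply: negligible_bigcup => n.
rewrite setI_bigcupr; apply: negligible_bigcup => m.
have [k _ [_ _ [C [Cincr ->]]]] := incrA n.
have [l _ [_ _ [D [Ddecr ->]]]] := decrB m.
rewrite setI_bigcupl; apply: negligible_bigcup_ord => i.
rewrite setI_bigcupr; apply: negligible_bigcup_ord => j.
apply: negligible_monotone_both => // p q [Cp Dp] [Cq Dq]; first exact: Cincr Cp Cq.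
exact: Ddecr Dp Dq.
Qed.

Lemma sub_unit_square_countable_unions P E :
  countable_unions (\bigcup_k closed_k_union P k) E -> E `<=` (unit_square : set (R * R)).
Proof. by move=> [A PA ->] x [n _]; have [k _ [+ _ _]] := PA n; apply. Qed.

Lemma carried_mrestr rho D (mD : measurable D) :
  carried_by_unit_square rho -> carried_by_unit_square (mrestr rho mD).
Proof.
move=> rhoU; apply: (@subset_measure0 _ _ _ rho _ (~` unit_square)) => //.
- by apply: measurableI mD; apply: measurableC; exact: measurable_unit_square.
- by apply: measurableC; exact: measurable_unit_square.
Qed.

(** The three components are the restrictions of [mu] to an increasing maximizer [E], to a
    decreasing maximizer [F], and to the complement of both. *)
Lemma monotone_decomposition_exists mu : prepermuton mu ->
  exists mi md ms, monotone_decomposition mu mi md ms.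
Proof.
move=> pmu; have [muU _ _] := pmu.
have incrP := @incr_classP R; have decrP := @decr_classP R.
have [E GE muE] := sup_mass_attained mu incrP.
have [F GF muF] := sup_mass_attained mu decrP.
have mE := measurable_countable_unions incrP GE.
have mF := measurable_countable_unions decrP GF.
have mS : measurable (~` (E `|` F)) by apply: measurableC; exact: measurableU.
have EU := sub_unit_square_countable_unions GE.
have FU := sub_unit_square_countable_unions GF.
have EF0 : mu (E `&` F) = 0.
  by apply/negligibleP; [exact: measurableI|exact: incr_decr_negligible].
exists (mrestr mu mE), (mrestr mu mF), (mrestr mu mS); split.
- by split; exact: carried_mrestr.
- move=> A mA; rewrite /= /mrestr.
  have mAE := measurableI _ _ mA mE; have mAF := measurableI _ _ mA mF.
  have mAEF := measurableI _ _ mA (measurableU _ _ mE mF).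
  rewrite (measureDI mu mA (measurableU _ _ mE mF)) addeC -setDE; congr (_ + _).
  (* Splitting both sides along [E] leaves one extra term on the right, the mass of a subset of the
     null set where [E] and [F] overlap. *)
  rewrite (measureDI mu mAEF mE) (measureDI mu mAF mE) addeC.
  rewrite [X in _ = _ + (_ + X)](@subset_measure0 _ _ _ _ _ (E `&` F)) ?adde0//.
  + congr (mu _ + mu _); apply/seteqP; split=> x /=; tauto.
  + exact: measurableI.
  + exact: measurableI.
  + by move=> x [[]].
- rewrite !LIS_inftyE (sup_mass_mrestr _ incrP (conj GE muE)) /= /mrestr.
  by rewrite setIid -muE (setIidr EU).
- rewrite !LDS_inftyE (sup_mass_mrestr _ decrP (conj GF muF)) /= /mrestr.
  by rewrite setIid -muF (setIidr FU).
Qed.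

Lemma incr_partP mu : prepermuton mu ->
  exists md ms, monotone_decomposition mu (incr_part mu) md ms.
Proof.
move=> /monotone_decomposition_exists muP.
exact: (@xgetPex {classic {finite_measure set (R * R)%type -> \bar R}} _
  [set mi | exists md ms, monotone_decomposition mu mi md ms]).
Qed.

(** The component [mi] is dominated by [mu], is exhausted by increasing sets, and has the maximal
    total mass, which forces it to be the restriction of [mu] to [E]. *)
Lemma monotone_decomposition_incrE mu mi md ms E :
    monotone_decomposition mu mi md ms -> mass_maximizer (@incr_class R) mu E ->
  forall A, measurable A -> mi A = mu (A `&` E).
Proof.
move=> [[miU mdU msU] muE [LISmi miLIS] _] Emax.
have miT : mi setT = mi unit_square by rewrite (carried_setI miU measurableT) setTI.
apply: (measure_eq_mrestr_maximizer (@incr_classP R) Emax).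
- by move=> A mA; rewrite muE// -addeA leeDl// adde_ge0.
- by rewrite -LIS_inftyE LISmi miT.
- by rewrite miT miLIS LIS_inftyE.
Qed.

(** * From [lambda] back to [LIS], and equality of the increasing parts *)

Lemma LIS_fin_num rho k : LIS k rho \is a fin_num.
Proof.
rewrite /LIS; case: k => [//|k]; rewrite ge0_fin_numE; last first.
  apply: ereal_sup_ubound; exists set0; last exact: measure0.
  by apply: (@closed_k_union_set0 R (@nondecreasing_set R)) => p q [].
apply: (@le_lt_trans _ _ (rho setT)); last first.
  by rewrite -ge0_fin_numE//; exact: fin_num_measure.
apply: ge_ereal_sup => _ [A [_ /closed_measurable_prod mA _] <-].
by apply: le_measure; rewrite ?inE.
Qed.

(** The rows telescope from [LIS 0], which is 0 on both sides. Entry [k] of [lambda] is the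
    increment from [LIS k] to [LIS k.+1], and finiteness of [LIS k] makes the subtraction
    reversible. *)
Lemma LIS_eq_of_lambda rho rho' p : lambda rho p = lambda rho' p ->
  forall k, LIS k (mrestr rho (measurable_rect p)) =
            LIS k (mrestr rho' (measurable_rect p)).
Proof.
move=> lamE; elim=> [//|k IHk].
have {}lamE := congr1 (@^~ k) lamE; rewrite /lambda in lamE.
rewrite -[LHS](@subeK _ _ _ (LIS_fin_num (mrestr rho (measurable_rect p)) k)).
by rewrite [X in X + _ = _]lamE IHk subeK// LIS_fin_num.
Qed.

End IncreasingPart.

Theorem proposition2p14 (R : realType) (mu nu : probability (R * R)%type R)
    (mu_prepermuton : prepermuton mu) (nu_prepermuton : prepermuton nu)
    (lambda_eq : forall p : R * R, unit_square p -> lambda mu p = lambda nu p) :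
  forall A : set (R * R), measurable A -> incr_part mu A = incr_part nu A.
Proof.
have incrP := @incr_classP R.
have [mdmu [msmu dmu]] := incr_partP mu_prepermuton.
have [mdnu [msnu dnu]] := incr_partP nu_prepermuton.
have [E GE muE] := sup_mass_attained mu incrP.
have [F GF nuF] := sup_mass_attained nu incrP.
have Emax : mass_maximizer (@incr_class R) mu E by [].
have Fmax : mass_maximizer (@incr_class R) nu F by [].
apply: measure_eq_rect; [by case: dmu => -[]|by case: dnu => -[]|].
move=> p /lambda_eq /LIS_eq_of_lambda /funext LISE.
have mp := measurable_rect p.
(* On a fixed rectangle each increasing part has the mass of its maximizer there, which is
   [LIS_infty] of the restricted measure, the limit of the values already identified in [LISE]. *)
rewrite (monotone_decomposition_incrE dmu Emax mp).
rewrite (monotone_decomposition_incrE dnu Fmax mp).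
rewrite [_ `&` E]setIC [_ `&` F]setIC -(sup_mass_mrestr mp incrP Emax).
rewrite -(sup_mass_mrestr mp incrP Fmax) -!LIS_inftyE.
by rewrite /LIS_infty LISE.
Qed.
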